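(* Let $G$ be a loopless multigraph and let $\mathcal{S}=\{E_1,E_2,\dots,E_k\}$ be a partition of $E(G)$ such that $G[E_i]$ is a complete graph for all $i=1,2,\dots,k$. Then $$\tau_G=\prod_{i=1}^k n_i^{\,n_i-2-n'_i}\sum_{T\in\mathcal{ST}_{(G\diamond\mathcal{S})/E(G)}}\ \prod_{i=1}^k n_i^{|E_T(v'_i)|},$$ where $n_i=|V(G[E_i])|$, $n'_i$ is the size of the set $\{v\in V(G[E_i]) : E_G(v)\not\subseteq E_i\}$, and $v'_i$ is the vertex of $(G\diamond\mathcal{S})/E(G)$ produced by contracting the set $V_i$ of all vertices of $G\diamond\mathcal{S}$ incident with edges of $E_i$.
   Context: Graphs are finite multigraphs without loops (parallel edges allowed). $E_G(v)$ is the set of edges of $G$ incident with $v$. For an edge set $E'$, $G[E']$ is the subgraph consisting of the edges in $E'$ and their end-vertices; $G/E'$ is obtained by contracting all edges in $E'$. A complete graph has no parallel edges. $\mathcal{ST}_H$ is the set of spanning trees of $H$ and $\tau_H=|\mathcal{ST}_H|$ (spanning trees are distinguished by their edge sets). The graph $G_{v\triangleleft E_0}$: for a vertex $v$ and $E_0\subseteq E_G(v)$, it is obtained from $G$ by adding a new vertex $v'$ and a new edge $vv'$, and changing the end $v$ of every edge in $E_G(v)-E_0$ to $v'$ (edges in $E_0$ stay at $v$). All edges of $G$ are regarded as edges of $G_{v\triangleleft E_0}$ (keeping their identity even though an end may change). The graph $G\diamond G_0$: for a subgraph $G_0$ of $G$, let $v_1,\dots,v_r$ be the vertices of $G_0$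 with $E_G(v_i)\ne E_{G_0}(v_i)$; then $G\diamond G_0=(\cdots((G_{v_1\triangleleft E_{G_0}(v_1)})_{v_2\triangleleft E_{G_0}(v_2)})\cdots)_{v_r\triangleleft E_{G_0}(v_r)}$. The graph $G\diamond\mathcal{S}$: for a family $\mathcal{S}=\{E_1,\dots,E_k\}$ of pairwise disjoint subsets of $E(G)$, $G\diamond\mathcal{S}=(\cdots((G\diamond G[E_1])\diamond G[E_2])\cdots)\diamond G[E_k]$, where at each step $G[E_j]$ means the subgraph of the current graph induced by the edge set $E_j$; the result does not depend on the order of $E_1,\dots,E_k$. Every edge of $G$ is considered as an edge of $G\diamond\mathcal{S}$, so $E(G)\subseteq E(G\diamond\mathcal{S})$ and $(G\diamond\mathcal{S})/E(G)$ is the graph obtained from $G\diamond\mathcal{S}$ by contracting all these edges. $E_T(v)$ is the set of edges of $T$ incident with $v$. *)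

(* Defs.v *)
From mathcomp Require Import all_boot.

Set Implicit Arguments.
Unset Strict Implicit.
Unset Printing Implicit Defensive.

(* Finite multigraphs. The order of the two ends of an edge is irrelevant:
   every notion below is symmetric in it. Loops are excluded by [loopless]. *)
Record mgraph := MGraph {
  vert : finType;
  edge : finType;
  ends : edge -> vert * vert
}.

Arguments ends {m} e.

Section Basic.
Variable G : mgraph.
Implicit Types (v x y : vert G) (e : edge G) (F T : {set edge G}).

Definition loopless : Prop := forall e, (ends e).1 != (ends e).2.

Definition joins e x y : bool := (ends e == (x, y)) || (ends e == (y, x)).

Definition incident e v : bool := (v == (ends e).1) || (v == (ends e).2).

Definition edges_at v : {set edge G} := [set e | incident e v].

(* [adj F] is adjacency in the spanning subgraph with edge set F. *)
Definition adj F : rel (vert G) := [rel x y | [exists e in F, joins e x y]].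

Definition connected F : bool := [forall x, forall y, connect (adj F) x y].

(* A cycle v_0 e_0 v_1 e_1 ... v_m e_m v_0 (all v_i distinct, all e_i distinct,
   e_i joining v_i to v_{i+1}) is the sequence of pairs (v_i, e_i). Loops and
   pairs of parallel edges are cycles of length 1 and 2. *)
Definition is_cycle F (c : seq (vert G * edge G)) : bool :=
  [&& c != [::], uniq (unzip1 c), uniq (unzip2 c),
      all (mem F) (unzip2 c) & cycle (fun a b => joins a.2 a.1 b.1) c].

(* The length of a cycle is at most the number of vertices, so bounding it
   loses nothing and makes acyclicity a boolean. *)
Definition acyclic F : bool :=
  [forall m : 'I_#|vert G|.+1, forall c : m.-tuple (vert G * edge G),
     ~~ is_cycle F c].

Definition spanning_tree T : bool := connected T && acyclic T.

Definition spanning_trees : {set {set edge G}} := [set T | spanning_tree T].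

Definition tau : nat := #|spanning_trees|.

Record subgraph := Subgraph {
  sub_verts : {set vert G};
  sub_edges : {set edge G};
  sub_closed : forall e v, e \in sub_edges -> incident e v -> v \in sub_verts
}.

Definition sub_edges_at (G0 : subgraph) v : {set edge G} :=
  edges_at v :&: sub_edges G0.

(* For subgraphs of loopless graphs. *)
Definition complete (G0 : subgraph) : Prop :=
  forall x y, x \in sub_verts G0 -> y \in sub_verts G0 -> x != y ->
  #|[set e in sub_edges G0 | joins e x y]| = 1.

Definition edge_verts F : {set vert G} :=
  [set v | [exists e in F, incident e v]].

Lemma edge_verts_closed F e v :
  e \in F -> incident e v -> v \in edge_verts F.
Proof.
by move=> eF ev; rewrite inE; apply/existsP; exists e; rewrite eF.
Qed.

(* The subgraph G[F]. *)
Definition edge_induced F : subgraph := Subgraph (@edge_verts_closed F).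

(* Contraction G/F: its vertices are the connected components of the spanning
   subgraph with edge set F. An edge outside F with both ends in one component
   would become a loop; it is kept, which does not affect spanning trees. *)
Definition component F x : {set vert G} := [set y | connect (adj F) x y].

Definition components F : {set {set vert G}} := [set component F x | x : vert G].

Lemma component_in F x : component F x \in components F.
Proof. exact: imset_f. Qed.

Definition contract_vert F : finType := {C : {set vert G} | C \in components F}.

Definition contract_proj F x : contract_vert F :=
  exist _ (component F x) (component_in F x).

Definition contract_edge F : finType := {e : edge G | e \notin F}.

Definition contract F : mgraph :=
  @MGraph (contract_vert F) (contract_edge F)
    (fun f => (contract_proj F (ends (sval f)).1,
               contract_proj F (ends (sval f)).2)).

End Basic.

(* A graph whose vertices and edges include those of G, the inclusions being
   the maps [ext_vert] and [ext_edge]; ends of edges may differ. *)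
Record extension (G : mgraph) := Extension {
  ext_graph : mgraph;
  ext_vert : vert G -> vert ext_graph;
  ext_edge : edge G -> edge ext_graph
}.

Definition ext_id (G : mgraph) : extension G := @Extension G G id id.

Definition ext_comp (G : mgraph) (X : extension G)
    (Y : extension (ext_graph X)) : extension G :=
  @Extension G (ext_graph Y) (fun v => ext_vert Y (ext_vert X v))
    (fun e => ext_edge Y (ext_edge X e)).

(* A set of edges of G, as a set of edges of the extension. *)
Definition ext_edges (G : mgraph) (X : extension G) (F : {set edge G}) :
    {set edge (ext_graph X)} := [set ext_edge X e | e in F].

(* The graph obtained from G at v and E0, for E0 a subset of E_G(v): the new
   vertex v' and the new edge vv' are both [None]. *)
Definition split_end (G : mgraph) (v : vert G) (E0 : {set edge G})
    (e : edge G) (x : vert G) : option (vert G) :=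
  if (x == v) && (e \notin E0) then None else Some x.

Definition split_graph (G : mgraph) (v : vert G) (E0 : {set edge G}) : mgraph :=
  @MGraph (option (vert G)) (option (edge G))
    (fun oe => if oe is Some e
               then (split_end v E0 e (ends e).1, split_end v E0 e (ends e).2)
               else (Some v, None)).

Definition split (G : mgraph) (v : vert G) (E0 : {set edge G}) : extension G :=
  @Extension G (split_graph v E0) Some Some.

Definition split_seq (G : mgraph) (s : seq (vert G * {set edge G})) :
    extension G :=
  foldl (fun X p =>
           ext_comp (split (ext_vert X p.1) (ext_edges X p.2)))
        (ext_id G) s.

(* G <> G0 *)
Definition diamond_sub (G : mgraph) (G0 : subgraph G) : extension G :=
  split_seq [seq (v, sub_edges_at G0 v)
            | v <- enum [set v in sub_verts G0
                        | edges_at v != sub_edges_at G0 v]].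

(* G <> {E_1, ..., E_k}, with E_1, ..., E_k given as a sequence. *)
Definition diamond (G : mgraph) (s : seq {set edge G}) : extension G :=
  foldl (fun X F =>
           ext_comp (diamond_sub (edge_induced (ext_edges X F))))
        (ext_id G) s.

(* Main.v *)
Require Import Defs.
From mathcomp Require Import all_boot all_fingroup all_algebra ring.

Set Implicit Arguments.
Unset Strict Implicit.
Unset Printing Implicit Defensive.

Import GRing.Theory Num.Theory.
Local Open Scope ring_scope.

(** Why the formula holds. Write [V_i] for the vertices of [G[E_i]], and let [K]
be the bipartite graph on the classes and the vertices of [G] in which the class
[i] is joined to each [v] in [V_i] by an edge of weight [n_i]. By the weighted
matrix-tree theorem ([matrix_tree]), the sum over the spanning trees [T] of a
graph of the product of the weights in [T] is [det (L + E_rr)], for [L] its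
weighted Laplacian and [r] any of its vertices. The proof evaluates this sum for
[K] with two choices of the root and two Schur complements.

- Root [K] at a vertex of [G] and eliminate the classes ([star_clique_fdet]). The
  classes form a diagonal block with entries [n_i ^ 2], and what the star of [i]
  leaves on [V_i] is [n_i Id - J], the Laplacian of the complete graph [G[E_i]].
  Hence the sum is the product of the [n_i ^ 2] times [tau G].

- Root [K] at a vertex of the contracted diamond [H] and eliminate the vertices
  of [G] lying in exactly one class ([pendant_fdet]). They are leaves of [K], the
  one at [i] having weight [n_i], and there are [n_i - n'_i] of them at [i]. What
  remains is the Laplacian of [H] in which the edges at [v'_i] have weight [n_i].
  Hence the sum is the product of the [n_i ^ (n_i - n'_i)] times the weighted sum
  over the spanning trees of [H].

Comparing the two values gives the theorem, provided that [H] is [K] without these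
leaves. In the diamond, each vertex [v] of [G] lying in several classes becomes a
star with one leaf per class, the edges of the class being attached to that leaf
([split_model_diamond]). Each [G[E_i]] stays connected, so contracting [E(G)]
merges all the leaves of class [i] into one vertex, leaves every centre alone, and
keeps the edges of the stars ([contract_bipartite]).

The matrix-tree theorem is obtained from the Cauchy-Binet formula applied to the
edges together with one extra edge from [r] to the ground: an [n]-subset of these
has a minor equal to 1 or -1 when it is the ground edge plus a spanning tree, and
to 0 otherwise. *)

(** * Determinants indexed by finite types *)

Definition fdet (R : comNzRingType) (T : finType) (A : T -> T -> R) : R :=
  \det (\matrix_(i, j) A (enum_val i) (enum_val j) : 'M_#|T|).

Lemma eq_fdet (R : comNzRingType) (T : finType) (A B : T -> T -> R) :
  A =2 B -> fdet A = fdet B.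
Proof.
by move=> AB; congr (\det _); apply/matrixP=> i j; rewrite !mxE AB.
Qed.

Lemma fdet_numbering (R : comNzRingType) (T : finType) (A : T -> T -> R)
    (n : nat) (h : 'I_n -> T) :
  bijective h -> fdet A = \det (\matrix_(i, j) A (h i) (h j)).
Proof.
move=> bij_h; have n_T : n = #|T| by rewrite -(bij_eq_card bij_h) card_ord.
subst n.
have inj_p : injective (enum_rank \o h).
  exact: inj_comp enum_rank_inj (bij_inj bij_h).
pose p := perm inj_p.
have hE i : h i = enum_val (p i) by rewrite permE /= enum_rankK.
set B := (X in _ = \det X).
have -> : B = perm_mx p *m (\matrix_(i, j) A (enum_val i) (enum_val j))
              *m (perm_mx p)^T.
  rewrite -row_permE tr_perm_mx -col_permE.
  by apply/matrixP=> i j; rewrite !mxE !hE.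
by rewrite !det_mulmx det_tr det_perm mulrAC -signr_addb addbb mul1r.
Qed.

Lemma fdet_reindex (R : comNzRingType) (T T' : finType) (h : T' -> T)
    (A : T -> T -> R) :
  bijective h -> fdet A = fdet (fun x y => A (h x) (h y)).
Proof.
move=> bij_h.
exact: (@fdet_numbering R T A #|T'| (fun i => h (enum_val i))
  (bij_comp bij_h (@enum_val_bij T'))).
Qed.

(** Schur complement. Clearing the rows of the diagonal block [Q] with a unipotent
matrix leaves a block upper triangular matrix. *)
Lemma fdet_elim (F : fieldType) (Q T : finType) (A : Q + T -> Q + T -> F)
    (d : Q -> F) :
    (forall q q', A (inl q) (inl q') = if q == q' then d q else 0) ->
    (forall q, d q != 0) ->
  fdet A = \prod_q d q *
    fdet (fun t t' => A (inr t) (inr t') -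
            \sum_q A (inr t) (inl q) * A (inl q) (inr t') / d q).
Proof.
move=> Ad d0.
pose h (i : 'I_(#|Q| + #|T|)) : Q + T :=
  match fintype.split i with
  | inl j => inl (enum_val j)
  | inr j => inr (enum_val j)
  end.
have bij_h : bijective h.
  exists (fun x => match x with inl q => lshift _ (enum_rank q)
                              | inr t => rshift _ (enum_rank t) end).
    by move=> i; rewrite /h; case: split_ordP => j ->; rewrite enum_valK.
  by case=> x; rewrite /h ?(unsplitK (inl _)) ?(unsplitK (inr _)) enum_rankK.
rewrite (fdet_numbering _ bij_h).
pose D := \matrix_(i, j) A (inl (enum_val i)) (inl (enum_val j)) : 'M_#|Q|.
pose B := \matrix_(i, j) A (inl (enum_val i)) (inr (enum_val j)) : 'M_(#|Q|, #|T|).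
pose C := \matrix_(i, j) A (inr (enum_val i)) (inl (enum_val j)) : 'M_(#|T|, #|Q|).
pose E := \matrix_(i, j) A (inr (enum_val i)) (inr (enum_val j)) : 'M_#|T|.
pose N := \matrix_(i, j) (A (inr (enum_val i)) (inl (enum_val j)) / d (enum_val j))
  : 'M_(#|T|, #|Q|).
have hl i : h (lshift _ i) = inl (enum_val i) by rewrite /h (unsplitK (inl _)).
have hr i : h (rshift _ i) = inr (enum_val i) by rewrite /h (unsplitK (inr _)).
have -> : (\matrix_(i, j) A (h i) (h j)) = block_mx D B C E.
  apply/matrixP=> i j; case: (split_ordP i) => i' ->;
    case: (split_ordP j) => j' ->;
    by rewrite ?(block_mxEul, block_mxEur, block_mxEdl, block_mxEdr) !mxE ?hl ?hr.
have DE : D = diag_mx (\row_j d (enum_val j)).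
  apply/matrixP=> i j; rewrite !mxE Ad (inj_eq enum_val_inj).
  by case: eqP => // ->.
have ND : N *m D = C.
  apply/matrixP=> i j; rewrite DE mul_mx_diag !mxE.
  by rewrite divfK.
have -> : block_mx D B C E =
    block_mx 1%:M 0 N 1%:M *m block_mx D B 0 (E - N *m B).
  rewrite mulmx_block !mul1mx !mul0mx !addr0 ND.
  by rewrite addrC subrK.
rewrite det_mulmx det_lblock !det1 !mul1r det_ublock; congr (_ * _).
  rewrite DE det_diag (reindex_onto enum_rank enum_val) => [|i _];
    last exact: enum_valK.
  by apply: eq_big => [q|q _]; rewrite ?enum_rankK ?eqxx // mxE enum_rankK.
congr (\det _); apply/matrixP=> i j; rewrite !mxE; congr (_ - _).
rewrite (reindex_onto enum_rank enum_val) => [|k _]; last exact: enum_valK.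
by apply: eq_big => [q|q _]; rewrite ?enum_rankK ?eqxx // !mxE enum_rankK mulrAC.
Qed.

(** The Cauchy-Binet formula, summed over all maps [f] instead of over the
[n]-subsets of [E]: each subset is then counted once per enumeration, whence the
factor [n!], and no enumeration of the subsets has to be chosen. Expanding the
rows gives the determinant as a sum over [f]; averaging over the permutations of
the indices of [f] produces the second determinant. *)
Lemma cauchy_binet_sym (R : comNzRingType) (n : nat) (E : finType)
    (u v : E -> 'I_n -> R) :
  (n`!)%:R * \det (\matrix_(i, j) \sum_e u e i * v e j) =
  \sum_(f : {ffun 'I_n -> E})
    \det (\matrix_(i, j) u (f i) j) * \det (\matrix_(i, j) v (f i) j).
Proof.
pose W (f : {ffun 'I_n -> E}) := \det (\matrix_(i, j) v (f i) j).
have expand : \det (\matrix_(i, j) \sum_e u e i * v e j) =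
    \sum_(f : {ffun 'I_n -> E}) (\prod_i u (f i) i) * W f.
  transitivity (\sum_(f : {ffun 'I_n -> E}) \sum_(s : 'S_n)
      (-1) ^+ s * \prod_i (u (f i) i * v (f i) (s i))).
    rewrite exchange_big; apply: eq_bigr => s _; rewrite -big_distrr /=.
    congr (_ * _).
    rewrite -(bigA_distr_bigA (fun i e => u e i * v e (s i))) /=.
    by apply: eq_bigr => i _; rewrite mxE.
  apply: eq_bigr => f _; rewrite big_distrr /=; apply: eq_bigr => s _.
  rewrite big_split mulrCA; congr (_ * (_ * _)).
  by apply: eq_bigr => i _; rewrite mxE.
have permute (s : 'S_n) : \det (\matrix_(i, j) \sum_e u e i * v e j) =
    \sum_(f : {ffun 'I_n -> E}) (-1) ^+ s * (\prod_i u (f (s i)) i) * W f.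
  rewrite expand (reindex (fun f : {ffun 'I_n -> E} => [ffun i => f (s i)])).
    apply: eq_bigr => f _; rewrite -mulrA mulrCA; congr (_ * _).
      by apply: eq_bigr => i _; rewrite ffunE.
    rewrite /W -det_perm -det_mulmx -row_permE; congr (\det _).
    by apply/matrixP => i j; rewrite !mxE ffunE.
  exists (fun f : {ffun 'I_n -> E} => [ffun i => f (s^-1%g i)]) => f _;
    by apply/ffunP=> i; rewrite !ffunE ?permK ?permKV.
rewrite -card_Sn mulr_natl -sumr_const (eq_bigr _ (fun s _ => permute s)).
rewrite exchange_big; apply: eq_bigr => f _ /=; rewrite -mulr_suml -det_tr.
congr (_ * _); apply: eq_big => [s|s _]; first by rewrite inE.
by congr (_ * _); apply: eq_bigr => i _; rewrite !mxE.
Qed.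

(** * Bridges and cycles *)

Section Bridges.
Variable G : mgraph.
Implicit Types (x y : vert G) (e : edge G) (F : {set edge G}).

Lemma joins_sym e x y : joins e x y = joins e y x.
Proof. by rewrite /joins orbC. Qed.

Lemma adj_sym F : symmetric (adj F).
Proof.
by move=> x y; apply: eq_existsb => e; rewrite joins_sym.
Qed.

Lemma connect_adj_sym F : connect_sym (adj F).
Proof. exact: sym_connect_sym (adj_sym F). Qed.

Lemma adj_ends F e : e \in F -> adj F (ends e).1 (ends e).2.
Proof.
by move=> eF; apply/existsP; exists e; rewrite eF /joins -surjective_pairing eqxx.
Qed.

Lemma joins_incident e x y z : joins e x y -> incident e z = (z == x) || (z == y).
Proof. by rewrite /incident; case/orP=> /eqP-> //=; rewrite orbC. Qed.

(** Choosing an edge for each step of a simple path gives distinct edges, since the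
edge leaving [x] cannot join two later vertices. The last condition says that the
result, closed up by an edge [e] at its last vertex, is the sequence of pairs that
[is_cycle] asks for. *)
Lemma path_edges F x p :
    path (adj F) x p -> uniq (x :: p) ->
  exists c : seq (vert G * edge G),
    [/\ unzip1 c = belast x p, uniq (unzip2 c), all (mem F) (unzip2 c),
        forall e y, e \in unzip2 c -> incident e y -> y \in x :: p &
        forall a e, path (fun a b => joins a.2 a.1 b.1) a
                      (rcons c (last x p, e)) = joins a.2 a.1 x].
Proof.
elim: p x => [|y p IHp] x /=.
  by move=> _ _; exists [::]; split=> // a e /=; rewrite andbT.
case/andP=> /existsP[e0 /andP[e0F e0xy]] /IHp{}IHp /andP[xyp /IHp].
case=> c [c1 c2 cF cinc cpath]; exists ((x, e0) :: c); split=> /=.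
- by rewrite c1.
- rewrite c2 andbT; apply: contra xyp => e0c; apply: cinc e0c _.
  by rewrite (joins_incident _ e0xy) eqxx.
- by rewrite cF andbT.
- move=> e z; rewrite inE => /predU1P[->|ec] einc.
    by move: einc; rewrite (joins_incident _ e0xy) !inE orbA => ->.
  by rewrite inE (cinc e z) ?orbT.
- by move=> a e; rewrite cpath e0xy andbT.
Qed.

Lemma walk_connect F (a z : vert G * edge G) c :
    path (fun a b => joins a.2 a.1 b.1) a (rcons c z) ->
    a.2 \in F -> all (mem F) (unzip2 c) ->
  connect (adj F) a.1 z.1.
Proof.
elim: c a => [|b c IHc] a /=.
  rewrite andbT => az aF _; apply: connect1; apply/existsP; exists a.2.
  by rewrite aF.
case/andP=> ab /IHc{}IHc aF /andP[bF /(IHc bF)]; apply: connect_trans.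
by apply: connect1; apply/existsP; exists a.2; rewrite aF.
Qed.

(** An edge [e] of [F] whose ends are still connected in [F - e] closes a simple path
into a cycle, and conversely a cycle minus one of its edges connects the ends of
that edge. *)
Lemma acyclicP F :
  reflect (forall e, e \in F ->
             ~~ connect (adj (F :\ e)) (ends e).1 (ends e).2)
          (acyclic F).
Proof.
apply: (iffP idP) => [acF e eF | bridges].
  apply/negP=> /connectP[p0 path_p0 last_p0].
  case/shortenP: path_p0 last_p0 => p path_p uniq_p _ last_p.
  have [c [c1 c2 cF _ cpath]] := path_edges path_p uniq_p.
  pose c' := ((ends e).2, e) :: c.
  have uniq_c' : uniq (unzip1 c').
    rewrite /= c1 last_p -(rcons_uniq (belast _ _)) -lastI.
    exact: uniq_p.
  have size_c' : (size c' < #|vert G|.+1)%N.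
    by rewrite ltnS -(size_map fst) -(card_uniqP uniq_c') max_card.
  move/forallP/(_ (Ordinal size_c'))/forallP/(_ (in_tuple c')): acF.
  rewrite /is_cycle uniq_c'; apply/negP; rewrite negbK /= c2 eF /=.
  apply/and3P; split.
  - rewrite andbT; apply/negP=> /(allP cF); by rewrite /= !inE eqxx.
  - by apply: sub_all cF => f; rewrite /= !inE => /andP[].
  - by rewrite last_p cpath -last_p /joins /= -surjective_pairing eqxx orbT.
apply/forallP=> m; apply/forallP=> c0; move: (tval c0) => c {m c0}.
apply/negP; case: c => [|[v e] c] // /and5P[_ _ /= /andP[ec _] /andP[eF cF] cyc].
have cFe : all (mem (F :\ e)) (unzip2 c).
  apply/allP=> f fc /=; rewrite !inE; have /= -> := allP cF f fc; rewrite andbT.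
  by apply: contraNneq ec => <-.
have [w evw con] : exists2 w, joins e v w & connect (adj (F :\ e)) w v.
  case: c cyc cFe {ec cF} => [|b c] /=; first by rewrite andbT; exists v.
  case/andP=> evb path_c /andP[bF cF]; exists b.1 => //.
  exact: walk_connect path_c bF cF.
have /negP[] := bridges e eF.
by case/orP: evw => /eqP-> //=; rewrite connect_adj_sym.
Qed.

End Bridges.

(** * The weighted matrix-tree theorem *)

Section MatrixTree.
Variable G : mgraph.
Implicit Types (x y z : vert G) (e : edge G) (F T : {set edge G}).
Local Notation n := #|vert G|.

Definition edge_vec (R : nzRingType) e x : R :=
  (x == (ends e).1)%:R - (x == (ends e).2)%:R.

Lemma edge_vec_joins (R : nzRingType) e x y :
  joins e x y -> exists s : R, s * s = 1 /\
     forall z, s * edge_vec R e z = (z == x)%:R - (z == y)%:R.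
Proof.
rewrite /edge_vec; case/orP=> /eqP->; [exists 1 | exists (-1)].
  by split=> [|z]; rewrite mul1r.
by split=> [|z]; rewrite mulN1r ?opprK ?opprB.
Qed.

(** Adding up the signed edge vectors along a path telescopes. The coefficients are
integers, which is why the minors of grounded trees are units. *)
Lemma connect_span F x y :
    connect (adj F) x y ->
  exists a : edge G -> int, forall z,
    \sum_(e in F) a e * edge_vec int e z = (z == x)%:R - (z == y)%:R.
Proof.
case/connectP=> p; elim: p x => [|x1 p IHp] x /=.
  by move=> _ ->; exists (fun=> 0) => z; rewrite big1 ?subrr // => e _; rewrite mul0r.
case/andP=> /existsP[e0 /andP[e0F /(edge_vec_joins int)[s [_ es]]]].
move=> /IHp{}IHp /IHp[a aE]; exists (fun e => (if e == e0 then s else 0) + a e) => z.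
under eq_bigr do rewrite mulrDl.
rewrite big_split /= aE (bigD1 e0) //= eqxx es big1 ?addr0.
  by rewrite addrA subrK.
by move=> e /andP[_ /negPf->]; rewrite mul0r.
Qed.

Lemma edge_vec_sum (R : nzRingType) e (g : vert G -> R) :
  \sum_x edge_vec R e x * g x = g (ends e).1 - g (ends e).2.
Proof.
under eq_bigr do rewrite mulrBl.
rewrite sumrB (bigD1 (ends e).1) //= [X in _ - X](bigD1 (ends e).2) //= !eqxx.
by rewrite !big1 => [|x /negPf->|x /negPf->]; rewrite ?mul0r // !mul1r !addr0.
Qed.

Lemma edge_vec_sum0 (R : nzRingType) F e (g : vert G -> R) :
    e \in F -> (forall x y, adj F x y -> g x = g y) ->
  \sum_x edge_vec R e x * g x = 0.
Proof. by move=> eF gF; rewrite edge_vec_sum (gF _ _ (adj_ends eF)) subrr. Qed.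

Lemma connect_adj_inv F x y z :
  adj F y z -> connect (adj F) x y = connect (adj F) x z.
Proof.
move=> yz; apply/idP/idP=> xc; apply: connect_trans xc _; apply: connect1 => //.
by rewrite adj_sym.
Qed.

(** The extra edge [None] joins the root to the ground. *)
Definition grounded F : {set option (edge G)} := None |: Some @: F.

Lemma card_grounded F : #|grounded F| = #|F|.+1.
Proof.
rewrite cardsU1 card_imset; last exact: Some_inj.
by case: imsetP => // -[].
Qed.

Lemma big_grounded (R : Type) (idx : R) (op : Monoid.com_law idx) F
    (Phi : option (edge G) -> R) :
  \big[op/idx]_(o in grounded F) Phi o =
    op (Phi None) (\big[op/idx]_(e in F) Phi (Some e)).
Proof.
rewrite big_setU1 ?big_imset //=; first by move=> ? ? _ _ [].
by apply/imsetP => -[].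
Qed.

Variable r : vert G.

Definition ground_vec (R : nzRingType) (o : option (edge G)) x : R :=
  if o is Some e then edge_vec R e x else (x == r)%:R.

Lemma connected_span F :
    connected F ->
  exists c : vert G -> option (edge G) -> int, forall x z,
    \sum_(o in grounded F) c x o * ground_vec int o z = (x == z)%:R.
Proof.
move=> conF.
have /fin_all_exists[a aE] x := connect_span (forallP (forallP conF x) r).
exists (fun x o => if o is Some e then a x e else 1) => x z.
by rewrite big_grounded /= aE mul1r addrC subrK eq_sym.
Qed.

(** With [U] the matrix whose rows are the vectors of the grounded tree, [U] has a
left inverse because the tree is connected, and a right inverse because every edge
is a bridge; hence it is square. *)
Lemma spanning_tree_card T : spanning_tree T -> #|T|.+1 = n.
Proof.
case/andP=> conT /acyclicP bridges; rewrite -card_grounded.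
pose U : 'M[int]_(#|grounded T|, n) :=
  \matrix_(i, j) ground_vec int (enum_val i) (enum_val j).
apply/eqP; rewrite eqn_leq; apply/andP; split.
  (* The column dual to [e] is the indicator of one side of the bridge [e],
     shifted by a constant so as to vanish at the root. *)
  pose near (o : option (edge G)) z : int :=
    if o is Some e then
      let c := connect (adj (T :\ e)) (ends e).1 in (c z)%:R - (c r)%:R
    else 1.
  pose N : 'M[int]_(n, #|grounded T|) :=
    \matrix_(j, i) near (enum_val i) (enum_val j).
  apply: (@mulmx1_min _ _ _ U N); apply/matrixP=> i i'.
  rewrite !mxE -(inj_eq enum_val_inj).
  rewrite (reindex_onto enum_rank enum_val) => [|k _]; last exact: enum_valK.
  rewrite (eq_big predT (fun x =>
      ground_vec int (enum_val i) x * near (enum_val i') x)) => [|x|x _]; last first.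
  - by rewrite !mxE enum_rankK.
  - by rewrite enum_rankK eqxx.
  have := enum_valP i; have := enum_valP i'.
  move: (enum_val i) (enum_val i') => o o' o'T oT {i i'}.
  have memT e : (Some e \in grounded T) = (e \in T).
    by rewrite !inE /= mem_imset //; apply: Some_inj.
  case: o oT => [e|] oT; last first.
    rewrite (bigD1 r) //= eqxx big1 => [|x /negPf->]; rewrite ?mul0r // addr0 mul1r.
    by case: o' o'T => [e'|] //= _; rewrite subrr.
  rewrite memT in oT; case: o' o'T => [e'|] o'T; last first.
    by rewrite /= (edge_vec_sum0 (F := T)).
  rewrite memT in o'T; rewrite (inj_eq (@Some_inj _)) /=.
  have [<-|ne] := eqVneq e e'.
    rewrite edge_vec_sum connect0 (negPf (bridges e oT)).
    by case: (connect _ _ r).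
  apply: (edge_vec_sum0 (F := T :\ e')); first by rewrite !inE ne.
  by move=> x y xy; rewrite (connect_adj_inv _ xy).
have [c cE] := connected_span conT.
pose M : 'M[int]_(n, #|grounded T|) :=
  \matrix_(j, i) c (enum_val j) (enum_val i).
apply: (@mulmx1_min _ _ _ M U); apply/matrixP=> j j'.
rewrite !mxE -(inj_eq enum_val_inj) -cE [RHS]big_enum_val.
by apply: eq_bigr => i _; rewrite !mxE.
Qed.

Definition ground_mx (R : nzRingType) (f : 'I_n -> option (edge G)) : 'M[R]_n :=
  \matrix_(i, j) ground_vec R (f i) (enum_val j).

Lemma ground_mx_unit (f : 'I_n -> option (edge G)) F :
    injective f -> f @: 'I_n = grounded F -> connected F ->
  \det (ground_mx int f) ^+ 2 = 1.
Proof.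
move=> inj_f imf /connected_span[c cE].
pose M : 'M[int]_n := \matrix_(j, i) c (enum_val j) (f i).
have MU : M *m ground_mx int f = 1%:M.
  apply/matrixP=> j j'; rewrite !mxE -(inj_eq enum_val_inj) -cE -imf.
  rewrite big_imset /=; last by move=> ? ? _ _; apply: inj_f.
  by apply: eq_bigr => i _; rewrite !mxE.
have /intUnitRing.unitzPl : \det M * \det (ground_mx int f) = 1.
  by rewrite -det_mulmx MU det1.
by case/orP=> /eqP->; rewrite ?sqrrN expr1n.
Qed.

(** A nonzero potential that takes equal values at the two ends of each edge [f i],
and vanishes at the root when the ground edge occurs, is in the kernel. *)
Lemma ground_mx_ker (f : 'I_n -> option (edge G)) (g : vert G -> int) x :
    g x != 0 -> (forall i, \sum_z ground_vec int (f i) z * g z = 0) ->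
  \det (ground_mx int f) = 0.
Proof.
move=> gx fg; rewrite -det_tr; apply/eqP/det0P.
exists (\row_j g (enum_val j)).
  apply: contraNneq gx => /rowP/(_ (enum_rank x)).
  by rewrite !mxE enum_rankK => ->.
apply/rowP=> i; rewrite !mxE; apply: etrans (fg i).
rewrite (reindex_onto enum_rank enum_val) => [|k _]; last exact: enum_valK.
by apply: eq_big => [z|z _]; rewrite ?enum_rankK ?eqxx // !mxE enum_rankK mulrC.
Qed.

(** Each failure of the conclusion exhibits a degenerate matrix: two equal rows, the
constant potential when the ground edge is absent, the indicator of a component
that misses the root, or a linear relation between the rows along a cycle. *)
Lemma ground_mx_tree (f : 'I_n -> option (edge G)) :
    \det (ground_mx int f) != 0 ->
  injective f /\ exists2 T, spanning_tree T & f @: 'I_n = grounded T.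
Proof.
move=> detf; have inj_f : injective f.
  apply/injectiveP; apply: contraNT detf => /injectivePn[i [i' ne fE]].
  by rewrite (determinant_alternate ne) // => j; rewrite !mxE fE.
pose T := [set e | Some e \in f @: 'I_n].
have imf : f @: 'I_n = grounded T.
  apply/setP=> -[e|].
    by rewrite in_setU1 /= mem_imset ?inE //; apply: Some_inj.
  rewrite !inE /=; apply: contraNT detf => noN.
  rewrite (@ground_mx_ker f (fun=> 1) r) // => i.
  case fi: (f i) noN => [e|] noN /=.
    by apply: (edge_vec_sum0 (F := [set e])); rewrite ?inE.
  by case/negP: noN; rewrite -fi imset_f.
split=> //; exists T => //.
have conTr x : connect (adj T) x r.
  apply: contraNT detf => xr.
  rewrite (@ground_mx_ker f (fun z => (connect (adj T) x z)%:R) x) ?connect0 // => i.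
  case fi: (f i) => [e|] /=.
    apply: (edge_vec_sum0 (F := T)); first by rewrite inE -fi imset_f.
    by move=> y z yz; rewrite (connect_adj_inv _ yz).
  rewrite (bigD1 r) //= eqxx (negPf xr) mulr0 add0r.
  by rewrite big1 // => z /negPf->; rewrite mul0r.
apply/andP; split.
  apply/forallP=> x; apply/forallP=> y; apply: connect_trans (conTr x) _.
  by rewrite connect_adj_sym.
apply/acyclicP=> e eT; apply: contraNN detf => /connect_span[a aE].
pose v o : int := if o is Some e' then (if e' == e then 1 else - a e') else 0.
apply/det0P; exists (\row_i v (f i)).
  have : Some e \in f @: 'I_n by rewrite inE in eT.
  case/imsetP=> i _ ei; apply/eqP=> /rowP/(_ i).
  by rewrite !mxE -ei /= eqxx.
apply/rowP=> j; rewrite !mxE.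
transitivity (\sum_(o in f @: 'I_n) v o * ground_vec int o (enum_val j)).
  rewrite big_imset /=; last by move=> ? ? _ _; apply: inj_f.
  by apply: eq_bigr => i _; rewrite !mxE.
rewrite imf big_grounded /= mul0r add0r (big_setD1 e) //= eqxx mul1r.
rewrite /edge_vec -aE -big_split big1 //= => e'; rewrite !inE => /andP[/negPf-> _].
by rewrite -mulrDl subrr mul0r.
Qed.

Lemma card_ffun_onto (m : nat) (J : finType) (A : {set J}) :
  #|A| = m -> #|[set f : {ffun 'I_m -> J} | f @: 'I_m == A]| = m`!.
Proof.
move=> Am; transitivity #|[set f : {ffun 'I_m -> J} in ffun_on A | injectiveb f]|;
  last by rewrite card_inj_ffuns_on card_ord Am ffactnn.
apply: eq_card => f; rewrite !inE; apply/eqP/andP=> [imf | [/ffun_onP fA inj_f]].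
  split; first by apply/ffun_onP=> i; rewrite -imf imset_f.
  apply/injectiveP=> i j; have /imset_injP inj_f : #|f @: 'I_m| == #|'I_m|.
    by rewrite imf Am card_ord.
  exact: inj_f.
apply/eqP; rewrite eqEcard Am card_imset ?card_ord ?leqnn ?andbT;
  last exact/injectiveP.
by apply/subsetP=> _ /imsetP[i _ ->]; apply: fA.
Qed.

Definition laplacian (w : edge G -> rat) x y : rat :=
  \sum_e w e * edge_vec rat e x * edge_vec rat e y.

(** In the Cauchy-Binet formula for [L + E_rr], the maps [f] that contribute are the
[n!] enumerations of the grounded spanning trees, each with a squared minor 1. *)
Theorem matrix_tree (w : edge G -> rat) :
  \sum_(T in spanning_trees G) \prod_(e in T) w e =
    fdet (fun x y => laplacian w x y + (x == r)%:R * (y == r)%:R).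
Proof.
pose w1 o := if o is Some e then w e else 1.
have n_fact : (n`!)%:R != 0 :> rat by rewrite pnatr_eq0 -lt0n fact_gt0.
apply: (mulfI n_fact); rewrite /fdet.
have -> : (\matrix_(i, j) (laplacian w (enum_val i) (enum_val j)
              + (enum_val i == r)%:R * (enum_val j == r)%:R) : 'M_n) =
    \matrix_(i, j) \sum_o (w1 o * ground_vec rat o (enum_val i))
                          * ground_vec rat o (enum_val j).
  apply/matrixP=> i j; rewrite !mxE.
  rewrite (eq_bigl (mem (grounded setT))) => [|[e|]]; first last.
  - by rewrite !inE.
  - by rewrite !inE /= imset_f ?inE.
  rewrite big_grounded /= mul1r addrC; congr (_ + _).
  by apply: eq_bigl => e; rewrite inE.
rewrite cauchy_binet_sym.
have detf (f : {ffun 'I_n -> option (edge G)}) :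
    \det (\matrix_(i, j) (w1 (f i) * ground_vec rat (f i) (enum_val j))) *
    \det (\matrix_(i, j) ground_vec rat (f i) (enum_val j)) =
    \sum_(T in spanning_trees G | f @: 'I_n == grounded T) \prod_(e in T) w e.
  have -> : \matrix_(i, j) (w1 (f i) * ground_vec rat (f i) (enum_val j)) =
            diag_mx (\row_i w1 (f i)) *m ground_mx rat f.
    by apply/matrixP=> i j; rewrite mul_diag_mx !mxE.
  rewrite -/(ground_mx rat f) det_mulmx det_diag -mulrA -expr2.
  have -> : ground_mx rat f = map_mx intr (ground_mx int f).
    apply/matrixP=> i j; rewrite !mxE /ground_vec /edge_vec.
    by case: (f i) => [e|]; rewrite ?intrB !mulrz_nat.
  rewrite det_map_mx -rmorphXn.
  have [det0|detN0] := eqVneq (\det (ground_mx int f)) 0.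
    rewrite det0 expr0n /= mulr0 big1 // => T /andP[].
    rewrite inE => treeT /eqP imf; case/andP: (treeT) => conT _.
    have inj_f : injective f.
      have /imset_injP inj_f : #|f @: 'I_n| == #|'I_n|.
        by rewrite imf card_grounded (spanning_tree_card treeT) card_ord.
      by move=> i j; apply: inj_f.
    by have := ground_mx_unit inj_f imf conT; rewrite det0 expr0n.
  have [inj_f [T treeT imf]] := ground_mx_tree detN0.
  have conT : connected T by case/andP: treeT.
  rewrite (ground_mx_unit inj_f imf conT) mulr1 (big_pred1 T) => [|T' /=].
    under eq_bigr do rewrite mxE.
    transitivity (\prod_(o in f @: 'I_n) w1 o).
      by rewrite big_imset //= => ? ? _ _; apply: inj_f.
    by rewrite imf big_grounded /= mul1r.
  rewrite inE imf; apply/andP/eqP=> [[_ /eqP gE]|->]; last by rewrite eqxx.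
  apply/setP=> e; have /setP/(_ (Some e)) := gE.
  by rewrite !in_setU1 /= !mem_imset //; apply: Some_inj.
rewrite (eq_bigr _ (fun f _ => detf f)) (exchange_big_dep (mem (spanning_trees G))) /= =>
  [|f T _ /andP[]] //.
rewrite mulr_sumr; apply: eq_bigr => T; rewrite inE => treeT.
rewrite sumr_const mulr_natl -(@card_ffun_onto n _ (grounded T)).
  by congr (_ *+ _); apply: eq_card => f; rewrite !inE treeT.
by rewrite card_grounded spanning_tree_card.
Qed.

End MatrixTree.

(** * The vertices and edges of the diamond *)

Section Splitting.
Variables (G : mgraph) (I : finType) (cl : edge G -> I).
Implicit Types (v : vert G) (e : edge G) (i : I) (D : {set vert G * I}).

Definition class_edges i : {set edge G} := [set e | cl e == i].

(** The graphs met while building the diamond are described by the set [D] of the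
pairs [(v, i)] such that the edges of class [i] have already been split off at [v].
Their vertices are the centres [(v, None)], one for each [v], and the leaves
[(v, Some i)], one for each pair in [D]; their edges are those of [G] and one edge
from leaf to centre for each pair in [D]. [locate] is the place where the edges of
class [i] at [v] end. *)
Definition locate D v i : vert G * option I :=
  (v, if (v, i) \in D then Some i else None).

Definition model_ends D (z : edge G + vert G * I) :=
  match z with
  | inl e => (locate D (ends e).1 (cl e), locate D (ends e).2 (cl e))
  | inr (v, i) => ((v, Some i), (v, None))
  end.

(** [pv] and [pe] name the vertices and edges of [Y] as above. *)
Record split_model D (Y : mgraph) (pv : vert Y -> vert G * option I)
    (pe : edge Y -> edge G + vert G * I) : Prop := SplitModel {
  model_inj_vert : injective pv;
  model_inj_edge : injective pe;
  model_centre : forall v, exists y, pv y = (v, None);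
  model_leaf : forall v i, (v, i) \in D <-> exists y, pv y = (v, Some i);
  model_old_edge : forall e, exists a, pe a = inl e;
  model_star_edge : forall d, d \in D <-> exists a, pe a = inr d;
  model_endsE : forall a, (pv (ends a).1, pv (ends a).2) = model_ends D (pe a)
}.

Definition old_edge_at i v (z : edge G + vert G * I) : bool :=
  if z is inl e then (cl e == i) && incident e v else false.

(** Splitting at the centre of [v] keeps the old vertex as the leaf of class [i],
and the new vertex takes over as the centre. *)
Lemma split_model_split D Y pv pe (y : vert Y) (E0 : {set edge Y}) v i :
    @split_model D Y pv pe -> pv y = (v, None) -> (v, i) \notin D ->
    (forall a, (a \in E0) = old_edge_at i v (pe a)) ->
  @split_model ((v, i) |: D) (split_graph y E0)
    (fun o => if o is Some x then if x == y then (v, Some i) else pv x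
              else (v, None))
    (fun o => if o is Some a then pe a else inr (v, i)).
Proof.
move=> [inj_v inj_e cen leaf old star endsE] yv vD E0E; split.
- have pvN x : x == y = false -> pv x <> (v, None).
    by move=> /eqP xy xv; apply: xy; apply: inj_v; rewrite xv.
  have pvS x : pv x <> (v, Some i).
    by move=> xv; case/negP: vD; apply/leaf; exists x.
  case=> [x|] [x'|] //=.
  + have [->|_] := eqVneq x y; have [->|_] := eqVneq x' y => //.
    * by move=> /esym E; case: (pvS _ E).
    * by move=> E; case: (pvS _ E).
    * by move/inj_v->.
  + by have [//|/negPf xy] := eqVneq x y => E; case: (pvN x xy E).
  + by have [//|/negPf xy] := eqVneq x' y => /esym E; case: (pvN x' xy E).
- have peN a : pe a <> inr (v, i) by move=> av; case/negP: vD; apply/star; exists a.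
  by case=> [a|] [a'|] //= => [/inj_e->//|E|/esym E]; case: (peN _ E).
- move=> u; have [->|uv] := eqVneq u v; first by exists None.
  have [x xu] := cen u; exists (Some x) => /=; case: eqP => // xy.
  by move: xu; rewrite xy yv => -[vu]; rewrite vu eqxx in uv.
- move=> u j; rewrite in_setU1; split=> [|[[x|]]] //=.
    case/predU1P=> [[-> ->]|/leaf[x xu]]; first by exists (Some y); rewrite /= eqxx.
    by exists (Some x) => /=; case: eqP => // xy; move: xu; rewrite xy yv.
  case: eqP => [_ [-> ->]|_ xu]; first by rewrite eqxx.
  by apply/orP; right; apply/leaf; exists x.
- by move=> e; have [a ae] := old e; exists (Some a).
- move=> d; rewrite in_setU1; split=> [|[[a|]]] //=.
  + by case/predU1P=> [->|/star[a ad]]; [exists None | exists (Some a)].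
  + by move=> ad; apply/orP; right; apply/star; exists a.
  + by move=> [->]; rewrite eqxx.
have old_end a e x u : pe a = inl e -> incident e u -> pv x = locate D u (cl e) ->
    (if split_end y E0 a x is Some x' then if x' == y then (v, Some i) else pv x'
     else (v, None)) = locate ((v, i) |: D) u (cl e).
  move=> ae eu xu; rewrite /split_end E0E ae /=.
  have [xy|xy] /= := eqVneq x y.
    move: xu; rewrite xy yv /locate in_setU1 xpair_eqE => -[uv].
    rewrite -uv in eu *; rewrite eu andbT eqxx; case: ifP => // _ _.
    by case: eqP => //= ->; rewrite eqxx.
  rewrite (negPf xy) xu /locate in_setU1; case: eqP => //= -[uv ci].
  by move: xy; rewrite -(inj_eq inj_v) yv xu /locate uv ci (negPf vD) eqxx.
case=> [a|] /=; last by rewrite eqxx.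
have := endsE a; case ae: (pe a) => [e|[u j]] /= [e1 e2].
  by congr pair; apply: old_end ae _ _ => //; rewrite /incident eqxx ?orbT.
rewrite /split_end E0E ae /= !andbT.
case: eqP => [xy|/eqP/negPf xy]; first by move: e1; rewrite xy yv.
rewrite xy e1; case: eqP => [xy'|/eqP/negPf->]; last by rewrite e2.
by move: e2; rewrite xy' yv => -[->].
Qed.

Lemma split_seq_rcons (H : mgraph) (s : seq (vert H * {set edge H})) p :
  split_seq (rcons s p) = ext_comp
    (Defs.split (ext_vert (split_seq s) p.1) (ext_edges (split_seq s) p.2)).
Proof. by rewrite /split_seq foldl_rcons. Qed.

(** The splittings of one diamond step take place at distinct centres and for the
same class, so none of them disturbs the next. *)
Lemma split_model_seq D Y pv pe (E0 : vert Y -> {set edge Y}) i (l : seq (vert Y)) :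
    @split_model D Y pv pe -> uniq l ->
    (forall y, y \in l -> exists v, [/\ pv y = (v, None), (v, i) \notin D &
        forall a, (a \in E0 y) = old_edge_at i v (pe a)]) ->
  let X := split_seq [seq (y, E0 y) | y <- l] in
  exists pv' pe',
    [/\ @split_model (D :|: [set ((pv y).1, i) | y in l]) (ext_graph X) pv' pe',
        forall a, pe' (ext_edge X a) = pe a &
        forall y, y \notin l -> pv' (ext_vert X y) = pv y].
Proof.
elim/last_ind: l => [|l y IHl] modY.
  move=> _ _; exists pv, pe; split=> //.
  rewrite (_ : [set _ | _ in _] = set0) ?setU0 //.
  by apply/setP=> d; rewrite inE; apply/imsetP => -[].
rewrite rcons_uniq => /andP[yl uniq_l] splittable.
have [|pv1 [pe1 [mod1 pe1E pv1E]]] := IHl modY uniq_l.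
  by move=> x xl; apply: splittable; rewrite mem_rcons inE xl orbT.
have [|v [yv vD E0E]] := splittable y; first by rewrite mem_rcons inE eqxx.
rewrite /= map_rcons split_seq_rcons /=.
move: (split_seq _) => X in pv1 pe1 mod1 pe1E pv1E *.
have y1v : pv1 (ext_vert X y) = (v, None) by rewrite pv1E.
have v1D : (v, i) \notin D :|: [set ((pv x).1, i) | x in l].
  rewrite inE (negPf vD) /=; apply/imsetP=> -[x xl [vx]].
  have [|u [xu _ _]] := splittable x; first by rewrite mem_rcons inE xl orbT.
  case/negP: yl; rewrite (_ : y = x) //; apply: (model_inj_vert modY).
  by rewrite yv xu vx xu.
have E1E a : (a \in ext_edges X (E0 y)) = old_edge_at i v (pe1 a).
  apply/imsetP/idP=> [[b bE ->]|]; first by rewrite pe1E -E0E.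
  case a1: (pe1 a) => [e|//] ei; have [b be] := model_old_edge modY e.
  exists b; first by rewrite E0E be.
  by apply: (model_inj_edge mod1); rewrite pe1E be.
have mod2 := split_model_split mod1 y1v v1D E1E.
do 2 eexists; split.
- rewrite (_ : _ :|: _ = (v, i) |: (D :|: [set ((pv x).1, i) | x in l])) //.
    exact: mod2.
  apply/setP=> d; rewrite !inE orbCA; congr (_ || _).
  apply/imsetP/idP=> [[x]|].
    rewrite mem_rcons inE => /predU1P[->|xl] ->; first by rewrite yv eqxx.
    by apply/orP; right; apply/imsetP; exists x.
  case/predU1P=> [->|/imsetP[x xl ->]].
    by exists y; rewrite ?yv // mem_rcons inE eqxx.
  by exists x => //; rewrite mem_rcons inE xl orbT.
- by move=> a; rewrite /= pe1E.
move=> x; rewrite mem_rcons inE negb_or => /andP[xy xl] /=.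
case: eqP => [xy1|_]; last exact: pv1E.
case/negP: xy; apply/eqP; apply: (model_inj_vert modY).
by rewrite -(pv1E x xl) xy1 y1v.
Qed.

(** The pairs split once the classes in [P] have been treated. *)
Definition split_pairs (P : {set I}) : {set vert G * I} :=
  [set d | [&& d.2 \in P, d.1 \in edge_verts (class_edges d.2)
             & ~~ (edges_at d.1 \subset class_edges d.2)]].

Lemma in_class_verts v i :
  reflect (exists2 e, cl e = i & incident e v) (v \in edge_verts (class_edges i)).
Proof.
rewrite inE; apply: (iffP existsP) => [[e]|[e ei ev]].
  by rewrite inE => /andP[/eqP ei ev]; exists e.
by exists e; rewrite inE ei eqxx.
Qed.

Lemma model_incident D Y pv pe (a : edge Y) (y : vert Y) :
    @split_model D Y pv pe ->
  incident a y = (pv y == (model_ends D (pe a)).1) || (pv y == (model_ends D (pe a)).2).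
Proof.
by move=> modY; rewrite -(model_endsE modY) /= !(inj_eq (model_inj_vert modY)).
Qed.

(** The point is that the test made in the current graph, whether the vertex has an
edge outside class [i], agrees with the same test at [v] in [G]: an edge of another
class [j] at [v] still ends at the centre if [(v, j)] has not been split, and
otherwise the edge from the leaf of [j] is there in its place. *)
Lemma split_model_diamond_sub (P : {set I}) i Y pv pe (F : {set edge Y}) :
    @split_model (split_pairs P) Y pv pe -> i \notin P ->
    (forall a, (a \in F) = if pe a is inl e then cl e == i else false) ->
  let X := diamond_sub (edge_induced F) in
  exists pv' pe', @split_model (split_pairs (i |: P)) (ext_graph X) pv' pe' /\
    forall a, pe' (ext_edge X a) = pe a.
Proof.
move=> modY iP FE; pose G0 := edge_induced F.
pose l := enum [set y in sub_verts G0 | edges_at y != sub_edges_at G0 y].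
have notD v : (v, i) \notin split_pairs P by rewrite inE /= (negPf iP).
have locE v : locate (split_pairs P) v i = (v, None).
  by rewrite /locate (negPf (notD v)).
have old_at a y v : pv y = (v, None) ->
    (a \in sub_edges_at G0 y) = old_edge_at i v (pe a).
  move=> yv; rewrite !inE FE (model_incident _ _ modY) yv.
  case: (pe a) => [e|[u j]] /=; last by rewrite andbF.
  by rewrite andbC; case: eqP => //= ->; rewrite !locE !xpair_eqE !andbT.
have in_F y : y \in edge_verts F -> exists v, pv y = (v, None).
  rewrite inE => /existsP[a /andP[]]; rewrite FE (model_incident _ _ modY).
  case: (pe a) => [e|//] /= /eqP->; rewrite !locE.
  by case/orP=> /eqP->; eexists.
have l_split y v : pv y = (v, None) ->
    (y \in l) = (v \in edge_verts (class_edges i)) &&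
                ~~ (edges_at v \subset class_edges i).
  move=> yv; rewrite mem_enum inE; apply/andP/andP.
    rewrite /= inE => -[/existsP[a /andP[aF ay]] nE].
    have : a \in sub_edges_at G0 y by rewrite inE /= aF inE ay.
    rewrite (old_at _ _ _ yv); case ae: (pe a) => [e|//] /= /andP[/eqP ei ev].
    split; first by apply/in_class_verts; exists e.
    apply: contra nE => sub; rewrite eqEsubset subsetIl andbT.
    apply/subsetP=> b by_; rewrite inE by_ /= FE.
    move: by_; rewrite inE (model_incident _ _ modY) yv.
    case be: (pe b) => [f|[u j]] /=.
      move=> fv; have : f \in edges_at v.
        rewrite inE /incident; move: fv; rewrite /locate !xpair_eqE.
        by case/orP=> /andP[-> _]; rewrite ?orbT.
      by move/(subsetP sub); rewrite inE.
    have : (u, j) \in split_pairs P by apply/(model_star_edge modY); exists b.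
    rewrite !inE /= !xpair_eqE andbF /= => /and3P[jP /existsP[f /andP[]]].
    rewrite inE => /eqP fj fu _ /andP[/eqP vu _].
    have /(subsetP sub) : f \in edges_at v by rewrite inE vu.
    by rewrite inE fj => /eqP ji; rewrite -ji jP in iP.
  case=> /in_class_verts[e ei ev] /subsetPn[f]; rewrite !inE => fv fi.
  have [a ae] := model_old_edge modY e; have aE0 : a \in sub_edges_at G0 y.
    by rewrite (old_at _ _ _ yv) ae /= ei eqxx.
  move: aE0; rewrite /sub_edges_at !inE /= => /andP[ay aF]; split.
    by apply/existsP; exists a; rewrite aF.
  apply/eqP => /setP.
  have [fD|fD] := boolP ((v, cl f) \in split_pairs P).
    have [b bf] := (model_star_edge modY (v, cl f)).1 fD.
    move/(_ b); rewrite !inE FE (model_incident _ _ modY) bf yv /= eqxx orbT.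
    by [].
  have [b bf] := model_old_edge modY f; move/(_ b).
  rewrite !inE FE (model_incident _ _ modY) bf yv /= (negPf fi) andbF.
  move: fv; rewrite /incident => /orP[] /eqP fv;
    by rewrite -fv /locate (negPf fD) eqxx ?orbT.
have [|y yl|pv' [pe' [mod' pe'E _]]] :=
    @split_model_seq _ _ _ _ (sub_edges_at G0) i l modY.
- exact: enum_uniq.
- have [|v yv] := in_F y; first by move: yl; rewrite mem_enum inE => /andP[].
  by exists v; split=> // a; apply: old_at.
exists pv', pe'; split; last exact: pe'E.
rewrite (_ : split_pairs (i |: P) = split_pairs P :|: [set ((pv y).1, i) | y in l]) //.
apply/setP=> -[v j]; rewrite !in_setU [in LHS]inE /= in_setU1 andb_orl.
rewrite [(_, _) \in split_pairs P]inE /= orbC; congr (_ || _).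
apply/andP/imsetP=> [[/eqP-> vi]|[y yl [-> ->]]].
  have [y yv] := model_centre modY v; exists y; last by rewrite yv.
  by rewrite (l_split _ _ yv).
have [|v' yv] := in_F y; first by move: yl; rewrite mem_enum inE => /andP[].
by move: yl; rewrite (l_split _ _ yv) yv eqxx.
Qed.

Lemma diamond_rcons (H : mgraph) (s : seq {set edge H}) F :
  diamond (rcons s F) =
  ext_comp (diamond_sub (edge_induced (ext_edges (diamond s) F))).
Proof. by rewrite /diamond foldl_rcons. Qed.

Lemma split_model_diamond (s : seq I) :
    uniq s ->
  let X := diamond [seq class_edges i | i <- s] in
  exists pv pe, @split_model (split_pairs [set i in s]) (ext_graph X) pv pe /\
    forall e, pe (ext_edge X e) = inl e.
Proof.
elim/last_ind: s => [|s i IHs].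
  move=> _ /=; exists (fun v => (v, None)), inl; split=> //.
  have -> : split_pairs [set i in [::]] = set0.
    by apply/setP=> d; rewrite !inE.
  split=> [? ? [] | ? ? [] | v | v i | e | d | e] //=.
  - by exists v.
  - by rewrite inE; split=> // -[].
  - by exists e.
  - by rewrite inE; split=> // -[].
  - by rewrite /locate !inE.
rewrite rcons_uniq => /andP[si /IHs[pv [pe [modX peE]]]].
rewrite /= map_rcons diamond_rcons /=; move: (diamond _) => X in pv pe modX peE *.
have [||pv' [pe' [mod' pe'E]]] :=
    @split_model_diamond_sub _ i _ _ _ (ext_edges X (class_edges i)) modX.
- by rewrite inE.
- move=> a; apply/imsetP/idP=> [[e eE ->]|]; first by rewrite peE inE in eE *.
  case ae: (pe a) => [e|//] ei; exists e; first by rewrite inE.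
  by apply: (model_inj_edge modX); rewrite peE.
exists pv', pe'; split; last by move=> e /=; rewrite pe'E.
rewrite (_ : [set j in rcons s i] = i |: [set j in s]) //.
by apply/setP=> j; rewrite !inE mem_rcons.
Qed.

End Splitting.

(** * The contracted diamond *)

Section Contraction.
Variables (G : mgraph) (I : finType) (cl : edge G -> I).
Implicit Types (v : vert G) (e : edge G) (i : I).
Local Notation class_verts i := (edge_verts (class_edges cl i)).
Local Notation D := (split_pairs cl setT).

Hypothesis class_nonempty : forall i, exists e, cl e = i.
Hypothesis class_clique : forall i u v,
  u \in class_verts i -> v \in class_verts i -> u != v ->
  exists2 e, cl e = i & joins e u v.

(** The class that contains all the edges at [v], for [v] not isolated. Nothing is
split at a vertex that has one. *)
Definition sole_class v : option I :=
  [pick i | (v \in class_verts i) && (edges_at v \subset class_edges cl i)].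

Lemma sole_classP v i :
  sole_class v = Some i <-> v \in class_verts i /\ edges_at v \subset class_edges cl i.
Proof.
rewrite /sole_class; split=> [|[vi sub]]; first by case: pickP => // j /andP[? ?] [<-].
case: pickP => [j /andP[/in_class_verts[e ej ev] _]|/(_ i)]; last by rewrite vi sub.
have /(subsetP sub) : e \in edges_at v by rewrite inE.
by rewrite inE ej => /eqP->.
Qed.

Lemma in_split_pairs v i :
  v \in class_verts i -> ((v, i) \in D) = (sole_class v == None).
Proof.
move=> vi; rewrite inE in_setT /= vi /=; apply/idP/eqP => [nsub|hv].
  case hv: (sole_class v) => [j|] //; have [vj sub] := (sole_classP _ _).1 hv.
  have [e ei ev] := in_class_verts _ _ _ vi.
  have /(subsetP sub) : e \in edges_at v by rewrite inE.
  by rewrite inE ei => /eqP ij; rewrite -ij (negPf nsub) in sub.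
by apply/negP=> sub; have := (sole_classP v i).2 (conj vi sub); rewrite hv.
Qed.

Lemma split_pairs_verts v i : (v, i) \in D -> v \in class_verts i.
Proof. by rewrite inE => /and3P[]. Qed.

Lemma sole_class_eq v i j : sole_class v = Some j -> v \in class_verts i -> i = j.
Proof.
case/sole_classP=> _ sub /in_class_verts[e ei ev].
have /(subsetP sub) : e \in edges_at v by rewrite inE.
by rewrite inE ei => /eqP.
Qed.

(** The vertex of the contracted diamond to which a leaf or a centre is sent. *)
Definition site (p : vert G * option I) : I + vert G :=
  if p.2 is Some i then inl i else if sole_class p.1 is Some i then inl i else inr p.1.

Lemma site_locate v i : v \in class_verts i -> site (locate D v i) = inl i.
Proof.
move=> vi; rewrite /site /locate /= (in_split_pairs vi).
by case hv: (sole_class v) => [j|] //=; rewrite (sole_class_eq hv vi).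
Qed.

Variables (X : extension G) (pv : vert (ext_graph X) -> vert G * option I).
Variable pe : edge (ext_graph X) -> edge G + vert G * I.
Hypotheses (modX : split_model cl D pv pe) (peE : forall e, pe (ext_edge X e) = inl e).

Lemma site_class y i :
  site (pv y) = inl i <-> exists2 v, v \in class_verts i & pv y = locate D v i.
Proof.
split=> [|[v vi ->]]; last exact: site_locate.
case yp: (pv y) => [v [j|]]; rewrite /site /=.
  move=> [<-]; have vD : (v, j) \in D by apply/(model_leaf modX); exists y.
  by exists v; [apply: split_pairs_verts | rewrite /locate vD].
case hv: (sole_class v) => [j|] // [<-]; have [vj _] := (sole_classP _ _).1 hv.
by exists v => //; rewrite /locate in_split_pairs // hv.
Qed.

Lemma site_centre y v : site (pv y) = inr v -> pv y = (v, None) /\ sole_class v = None.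
Proof.
by rewrite /site; case: (pv y) => u [j|] //=; case hu: (sole_class u) => // -[<-].
Qed.

Local Notation EG := (ext_edges X [set: edge G]).

Lemma old_edgeP a : reflect (exists e, pe a = inl e) (a \in EG).
Proof.
apply: (iffP imsetP) => [[e _ ->]|[e ae]]; first by exists e.
by exists e => //; apply: (model_inj_edge modX); rewrite peE.
Qed.

Lemma old_edge_ends a e : pe a = inl e ->
  [/\ pv (ends a).1 = locate D (ends e).1 (cl e) &
      pv (ends a).2 = locate D (ends e).2 (cl e)].
Proof. by move=> ae; have := model_endsE modX a; rewrite ae => -[? ?]. Qed.

Lemma end_class e v : incident e v -> v \in class_verts (cl e).
Proof. by move=> ev; apply/in_class_verts; exists e. Qed.

(** Old edges stay within one class, and any two vertices of a class are joined by
an old edge since the class is complete. *)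
Lemma connect_site x y : connect (adj EG) x y = (site (pv x) == site (pv y)).
Proof.
apply/idP/eqP => [/connectP[p]|xy].
  elim: p x => [|z p IHp] x /=; first by move=> _ ->.
  case/andP=> /existsP[a /andP[/old_edgeP[e ae] axz]] /IHp{}IHp /IHp <-.
  have [e1 e2] := old_edge_ends ae.
  have s1 : site (pv (ends a).1) = inl (cl e).
    by rewrite e1 site_locate // end_class // /incident eqxx.
  have s2 : site (pv (ends a).2) = inl (cl e).
    by rewrite e2 site_locate // end_class // /incident eqxx orbT.
  by case/orP: axz => /eqP aE; rewrite aE in s1 s2; rewrite s1 s2.
case sx: (site (pv x)) => [i|v]; last first.
  have [xv _] := site_centre sx; rewrite xy in sx; have [yv _] := site_centre sx.
  by rewrite (model_inj_vert modX (etrans xv (esym yv))).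
have [u ui xu] := (site_class _ _).1 sx; rewrite xy in sx.
have [v vi yv] := (site_class _ _).1 sx.
have [uv|uv] := eqVneq u v.
  by rewrite (model_inj_vert modX (_ : pv x = pv y)) ?connect0 // xu yv uv.
have [e ei euv] := class_clique ui vi uv; have [a ae] := model_old_edge modX e.
apply: connect1; apply/existsP; exists a; apply/andP; split.
  by apply/old_edgeP; exists e.
have [] := old_edge_ends ae; rewrite ei /joins.
case/orP: euv => /eqP->; rewrite /= -xu -yv => /(model_inj_vert modX)<-
  /(model_inj_vert modX)<-; by rewrite -surjective_pairing eqxx ?orbT.
Qed.

Local Notation H := (contract EG).

Lemma contract_proj_site x y :
  (contract_proj EG x == contract_proj EG y) = (site (pv x) == site (pv y)).
Proof.
rewrite -val_eqE /= -connect_site; apply/eqP/idP => [cE|xy].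
  have : y \in component EG y by rewrite inE connect0.
  by rewrite -cE inE.
apply/setP=> z; rewrite !inE.
apply/idP/idP; apply: connect_trans => //.
by rewrite connect_adj_sym.
Qed.

Lemma contract_proj_surj (C : vert H) : exists x, C = contract_proj EG x.
Proof.
case: C => C CC; have /imsetP[x _ Cx] := CC; exists x.
by apply: val_inj.
Qed.

(** [theta] and [phi] identify the contracted diamond with the bipartite graph whose
edges are the split pairs; its vertices are all the classes, and the vertices of
[G] with no sole class. *)
Lemma contract_bipartite :
  exists (theta : vert H -> I + vert G) (phi : edge H -> vert G * I)
         (v' : I -> vert H),
    [/\ injective theta /\ injective phi,
        forall i, theta (v' i) = inl i,
        forall v, sole_class v = None <-> exists C, theta C = inr v,
        forall d, d \in D <-> exists f, phi f = d &
        forall f, theta (ends f).1 = inl (phi f).2 /\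
                  theta (ends f).2 = inr (phi f).1]
    /\ forall i, edge_verts (ext_edges X (class_edges cl i)) =
                 [set x | contract_proj EG x == v' i].
Proof.
have /fin_all_exists[theta thetaP] (C : vert H) :
    exists t, exists2 x, C = contract_proj EG x & t = site (pv x).
  by have [x ->] := contract_proj_surj C; exists (site (pv x)), x.
have thetaE x : theta (contract_proj EG x) = site (pv x).
  by have [y /eqP] := thetaP (contract_proj EG x); rewrite contract_proj_site => /eqP->.
have /fin_all_exists[phi phiE] (f : edge H) : exists d, pe (sval f) = inr d.
  case: f => a aE /=; case ae: (pe a) => [e|d]; last by exists d.
  by case/negP: aE; apply/old_edgeP; exists e.
have /fin_all_exists[v' v'E] i : exists C, theta C = inl i.
  have [e ei] := class_nonempty i.
  have [a ae] := model_old_edge modX e; exists (contract_proj EG (ends a).1).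
  have [a1 _] := old_edge_ends ae.
  by rewrite thetaE a1 site_locate ?ei // -ei end_class // /incident eqxx.
have inj_theta : injective theta.
  move=> C C'; have [x -> ->] := thetaP C; have [y -> ->] := thetaP C'.
  by move/eqP; rewrite -contract_proj_site => /eqP.
exists theta, phi, v'; split; first split=> //.
- split=> // f f' ff'; apply: val_inj; apply: (model_inj_edge modX).
  by rewrite !phiE ff'.
- move=> v; split=> [hv|[C]]; last first.
    by have [x _ ->] := thetaP C; case/site_centre.
  have [x xv] := model_centre modX v; exists (contract_proj EG x).
  by rewrite thetaE xv /site /= hv.
- move=> d; split=> [/(model_star_edge modX)[a ad]|[f <-]]; last first.
    by apply/(model_star_edge modX); exists (sval f).
  have aE : a \notin EG by apply/old_edgeP => -[e]; rewrite ad.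
  by exists (exist _ a aE); have := phiE (exist _ a aE); rewrite /= ad => -[].
- move=> f; have := model_endsE modX (sval f).
  have : phi f \in D by apply/(model_star_edge modX); exists (sval f).
  rewrite /= !thetaE phiE; case: (phi f) => v i vD /= [-> ->]; split=> //.
  have := in_split_pairs (split_pairs_verts vD); rewrite vD => /esym/eqP hv.
  by rewrite /site /= hv.
move=> i; apply/setP=> y; rewrite [RHS]inE -(inj_eq inj_theta) thetaE v'E.
rewrite inE; apply/existsP/eqP => [[a /andP[/imsetP[e]]]|].
  rewrite inE => /eqP ei -> ay; apply/site_class.
  have [e1 e2] := old_edge_ends (peE e).
  case/orP: ay => /eqP->; [exists (ends e).1 | exists (ends e).2];
    by rewrite ?e1 ?e2 -ei // end_class // /incident eqxx ?orbT.
case/site_class=> v /in_class_verts[e ei ev] yv; exists (ext_edge X e).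
rewrite imset_f ?inE ?ei //= (model_incident _ _ modX) peE /= ei.
by case/orP: ev => /eqP <-; rewrite yv eqxx ?orbT.
Qed.

End Contraction.

(** * Replacing cliques by stars *)

Lemma sum_delta (R : nzRingType) (T : finType) (f : T -> R) x :
  \sum_y f y * (x == y)%:R = f x.
Proof.
rewrite (bigD1 x) //= eqxx mulr1 big1 ?addr0 // => y /negPf yx.
by rewrite eq_sym yx mulr0.
Qed.

Lemma laplacian_sym G w : forall x y, @laplacian G w x y = laplacian w y x.
Proof. by move=> x y; apply: eq_bigr => e _; rewrite mulrAC. Qed.

Section StarClique.
Variables (G : mgraph) (I : finType) (cl : edge G -> I).
Implicit Types (v : vert G) (e : edge G) (i : I).
Local Notation class_verts i := (edge_verts (class_edges cl i)).
Local Notation D := (split_pairs cl setT).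
Local Notation sole_class := (sole_class cl).

Hypothesis loopless_G : loopless G.
Hypothesis class_nonempty : forall i, exists e, cl e = i.
Hypothesis class_complete : forall i, complete (edge_induced (class_edges cl i)).

Definition class_order i : rat := #|class_verts i|%:R.

Lemma class_order_neq0 i : class_order i != 0.
Proof.
have [e ei] := class_nonempty i; rewrite pnatr_eq0 -lt0n card_gt0.
apply/set0Pn; exists (ends e).1; apply/in_class_verts; exists e => //.
by rewrite /incident eqxx.
Qed.

Lemma edge_vec_mul e v v' : v != v' ->
  edge_vec rat e v * edge_vec rat e v' = - (joins e v v')%:R.
Proof.
rewrite /edge_vec /joins; have := loopless_G e; case: (ends e) => a b /= ab vv'.
rewrite !xpair_eqE ![a == _]eq_sym ![b == _]eq_sym.
have [va|va] := eqVneq v a; have [vb|vb] := eqVneq v b;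
  have [v'a|v'a] := eqVneq v' a; have [v'b|v'b] := eqVneq v' b => //=;
  rewrite ?(subrr, mul0r, mulr0, subr0, sub0r, mulr1, mul1r, oppr0, mulrN, mulNr) //;
  subst; by rewrite ?eqxx in ab vv' *.
Qed.

(** The entries off the diagonal count the edges joining the two vertices; the
diagonal follows since the rows sum to zero. *)
Lemma clique_laplacian i v v' :
  \sum_(e | cl e == i) edge_vec rat e v * edge_vec rat e v' =
  (v \in class_verts i)%:R * (v' \in class_verts i)%:R *
    ((v == v')%:R * class_order i - 1).
Proof.
have offdiag u u' : u != u' ->
    \sum_(e | cl e == i) edge_vec rat e u * edge_vec rat e u' =
    - ((u \in class_verts i)%:R * (u' \in class_verts i)%:R).
  move=> uu'; under eq_bigr do rewrite edge_vec_mul //.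
  rewrite sumrN; congr (- _).
  have [/andP[ui u'i]|nui] := boolP ((u \in class_verts i) && (u' \in class_verts i)).
    rewrite ui u'i mulr1 -[1%:R in RHS](congr1 _ (class_complete ui u'i uu')).
    rewrite -sum1_card natr_sum big_mkcond [RHS]big_mkcond.
    by apply: eq_bigr => e _; rewrite !inE; case: eqP; case: joins.
  rewrite -natrM mulnb (negPf nui) big1 // => e /eqP ei.
  case: (boolP (joins e u u')) => // euu'; case/negP: nui.
  by apply/andP; split; apply/in_class_verts; exists e => //;
    rewrite (joins_incident _ euu') eqxx ?orbT.
have [<-|/offdiag->] := eqVneq v v'; last first.
  by rewrite mul0r sub0r mulrN1.
have rowsum : \sum_u \sum_(e | cl e == i) edge_vec rat e v * edge_vec rat e u = 0.
  rewrite exchange_big big1 // => e _; rewrite -mulr_sumr.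
  under eq_bigr do rewrite -[edge_vec _ _ _]mulr1.
  by rewrite edge_vec_sum subrr mulr0.
rewrite (bigD1 v) //= in rowsum; move/eqP: rowsum; rewrite addr_eq0 => /eqP->.
under eq_bigr => u uv do rewrite offdiag 1?eq_sym //.
rewrite sumrN opprK -mulr_sumr.
have [vi|_] := boolP (v \in _); last by rewrite !mul0r.
rewrite !mul1r; apply/eqP; rewrite -subr_eq opprK addrC; apply/eqP.
transitivity (\sum_u (u \in class_verts i)%:R : rat).
  by rewrite [RHS](bigD1 v) //= vi.
rewrite /class_order -sum1_card natr_sum [RHS]big_mkcond.
by apply: eq_bigr => u _; case: ifP.
Qed.

(** The graph [K]. Its edges are all the pairs, those that are not incidences having
weight zero, so that sums over edges are double sums. *)
Definition incidence_graph : mgraph :=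
  @MGraph (I + vert G)%type (vert G * I)%type (fun d => (inl d.2, inr d.1)).
Local Notation K := incidence_graph.

Definition star_weight (d : edge K) : rat :=
  if d.1 \in class_verts d.2 then class_order d.2 else 0.

Lemma edge_vec_class (d : edge K) i : edge_vec rat d (inl i : vert K) = (i == d.2)%:R.
Proof. by rewrite /edge_vec /= subr0. Qed.

Lemma edge_vec_vert (d : edge K) v : edge_vec rat d (inr v : vert K) = - (v == d.1)%:R.
Proof. by rewrite /edge_vec /= sub0r. Qed.

Lemma sum_pairs (F : vert G * I -> rat) : \sum_d F d = \sum_v \sum_i F (v, i).
Proof. by rewrite pair_bigA; apply: eq_bigr => -[]. Qed.

Lemma star_laplacian_ll i i' :
  laplacian star_weight (inl i : vert K) (inl i' : vert K) =
  if i == i' then class_order i ^+ 2 else 0.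
Proof.
rewrite /laplacian; under eq_bigr do rewrite !edge_vec_class.
rewrite sum_pairs /=.
under eq_bigr do under eq_bigr do rewrite mulrAC.
under eq_bigr do rewrite sum_delta.
rewrite -mulr_suml eq_sym /star_weight /= -big_mkcond sumr_const.
rewrite -[class_order i *+ _]mulr_natr -expr2.
by case: eqP => _; rewrite ?mulr0 // mulr1.
Qed.

Lemma star_laplacian_rl v i :
  laplacian star_weight (inr v : vert K) (inl i : vert K) = - star_weight (v, i).
Proof.
rewrite /laplacian; under eq_bigr do rewrite edge_vec_class edge_vec_vert mulrN mulNr.
rewrite sumrN sum_pairs /=; congr (- _).
under eq_bigr do rewrite sum_delta.
by rewrite sum_delta.
Qed.

Lemma star_laplacian_lr v i :
  laplacian star_weight (inl i : vert K) (inr v : vert K) = - star_weight (v, i).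
Proof. by rewrite laplacian_sym star_laplacian_rl. Qed.

Lemma star_laplacian_rr v v' :
  laplacian star_weight (inr v : vert K) (inr v' : vert K) =
  (v == v')%:R * \sum_i star_weight (v, i).
Proof.
rewrite /laplacian; under eq_bigr do rewrite !edge_vec_vert mulrN mulrN mulNr opprK.
rewrite sum_pairs /=.
under eq_bigr do under eq_bigr do rewrite mulrAC.
under eq_bigr do rewrite -mulr_suml.
by rewrite sum_delta -mulr_suml mulrC eq_sym.
Qed.

Lemma star_clique_fdet (r : vert G) :
  fdet (fun x y : vert K => laplacian star_weight x y
                            + (x == inr r)%:R * (y == inr r)%:R) =
  \prod_i class_order i ^+ 2 *
    fdet (fun x y => laplacian (fun=> 1) x y + (x == r)%:R * (y == r)%:R).
Proof.
rewrite (@fdet_elim rat I (vert G) _ (fun i => class_order i ^+ 2)); first last.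
- by move=> i; rewrite expf_neq0 ?class_order_neq0.
- by move=> i i'; rewrite mul0r addr0 star_laplacian_ll.
congr (_ * _); apply: eq_fdet => v v'.
rewrite star_laplacian_rr addrAC; congr (_ + _).
rewrite mulr_sumr -sumrB [RHS](partition_big cl predT) //=.
apply: eq_bigr => i _; under [RHS]eq_bigr do rewrite mul1r.
rewrite clique_laplacian !mulr0 !mul0r !addr0 star_laplacian_lr star_laplacian_rl.
have := class_order_neq0 i; rewrite /star_weight /=; move: (class_order i) => m m0.
have [<-|_] := eqVneq v v'.
  by case: (v \in _);
    rewrite ?(mul1r, mul0r, oppr0, subr0) // mulrNN -expr2 divff // expf_neq0.
case: (v \in _); case: (v' \in _);
  rewrite ?(mul1r, mul0r, mulr0, oppr0, subr0, sub0r, mulr1) //.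
by rewrite mulrNN -expr2 divff // expf_neq0.
Qed.

End StarClique.

(** * Eliminating the vertices that lie in a single class *)

Section Pendants.
Variables (G : mgraph) (I : finType) (cl : edge G -> I).
Implicit Types (v : vert G) (e : edge G) (i : I).
Local Notation class_verts i := (edge_verts (class_edges cl i)).
Local Notation D := (split_pairs cl setT).
Local Notation sole_class := (sole_class cl).
Local Notation K := (incidence_graph G I).
Local Notation class_order := (class_order cl).
Local Notation star_weight := (star_weight cl).

Hypothesis class_nonempty : forall i, exists e, cl e = i.

Variables (H : mgraph) (theta : vert H -> I + vert G) (phi : edge H -> vert G * I).
Variable v' : I -> vert H.
Hypotheses (inj_theta : injective theta) (inj_phi : injective phi).
Hypothesis theta_class : forall i, theta (v' i) = inl i.
Hypothesis theta_centre : forall v, sole_class v = None <-> exists C, theta C = inr v.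
Hypothesis phi_pairs : forall d, d \in D <-> exists f, phi f = d.
Hypothesis theta_ends :
  forall f, theta (ends f).1 = inl (phi f).2 /\ theta (ends f).2 = inr (phi f).1.

Definition sole_order v : rat := if sole_class v is Some i then class_order i else 1.

Definition quotient_weight (f : edge H) : rat := class_order (phi f).2.

(** A vertex with a sole class is a leaf of [K], up to edges of weight zero. *)
Lemma sum_pendant v h (F : I -> rat) :
  sole_class v = Some h -> \sum_j star_weight (v, j) * F j = class_order h * F h.
Proof.
move=> hv; rewrite (bigD1 h) //= big1 ?addr0 => [|j jh].
  by rewrite /star_weight /= ((sole_classP cl v h).1 hv).1.
rewrite /star_weight /=; case: ifP => [vj|_]; last by rewrite mul0r.
by rewrite (sole_class_eq hv vj) eqxx in jh.
Qed.

Lemma edge_vec_phi f C :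
  edge_vec rat (phi f : edge K) (theta C : vert K) = edge_vec rat f C.
Proof.
have [e1 e2] := theta_ends f.
by rewrite /edge_vec -!(inj_eq inj_theta) e1 e2.
Qed.

Lemma theta_pendant v C : sole_class v != None -> (theta C == inr v) = false.
Proof.
by move=> hv; apply/negP=> /eqP Cv; case/eqP: hv; apply/theta_centre; exists C.
Qed.

(** The edges of [K] that are not split pairs hang the vertices with a sole class on
their class; the second sum is their contribution, which the Schur complement
cancels. *)
Lemma star_laplacian_quotient C C' :
  laplacian star_weight (theta C : vert K) (theta C' : vert K) =
  laplacian quotient_weight C C' +
  \sum_(v | sole_class v != None) sole_order v *
     (if sole_class v is Some h
      then (theta C == inl h)%:R * (theta C' == inl h)%:R else 0).
Proof.
rewrite /laplacian (bigID (mem D)) /=; congr (_ + _).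
  have -> : D = phi @: setT.
    apply/setP=> d; apply/idP/imsetP => [/phi_pairs[f <-]|[f _ ->]]; first by exists f.
    by apply/phi_pairs; exists f.
  rewrite big_imset /=; last by move=> ? ? _ _; apply: inj_phi.
  apply: eq_big => [f|f _]; first by rewrite inE.
  rewrite !edge_vec_phi /star_weight /quotient_weight.
  by rewrite (@split_pairs_verts _ _ _ (phi f).1) // -surjective_pairing;
    apply/phi_pairs; exists f.
rewrite big_mkcond sum_pairs [RHS]big_mkcond; apply: eq_bigr => v _ /=.
case hv: (sole_class v) => [h|] /=; last first.
  rewrite big1 // => j _; case: ifP => // /negP vj.
  rewrite /star_weight /=; case: ifP => [vjc|_]; last by rewrite !mul0r.
  by case: vj; rewrite in_split_pairs // hv.
have -> : sole_order v = class_order h by rewrite /sole_order hv.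
rewrite -(sum_pendant (fun j => _ * _) hv); apply: eq_bigr => j _.
have vC B : edge_vec rat ((v, j) : edge K) (theta B : vert K) = (theta B == inl j)%:R.
  by rewrite /edge_vec /= theta_pendant ?subr0 // hv.
rewrite !vC mulrA; case: ifP => //.
rewrite /star_weight /=; case: ifP => vj; last by rewrite !mul0r.
by rewrite in_split_pairs // hv.
Qed.

Lemma star_laplacian_pendant C v h : sole_class v = Some h ->
  laplacian star_weight (theta C : vert K) (inr v : vert K) =
  - (class_order h * (theta C == inl h)%:R).
Proof.
move=> hv; rewrite -(sum_pendant (fun j => _) hv).
rewrite /laplacian; under eq_bigr do rewrite edge_vec_vert mulrN.
rewrite sumrN sum_pairs /=; congr (- _).
rewrite exchange_big /=; apply: eq_bigr => j _; rewrite sum_delta; congr (_ * _).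
by rewrite /edge_vec /= theta_pendant ?subr0 // hv.
Qed.

(** A vertex hanging on the class [h] with weight [m] has diagonal entry [m], and its
elimination subtracts [m * m / m] from the diagonal entry of [h]. *)
Lemma pendant_fdet (C0 : vert H) :
  fdet (fun x y : vert K => laplacian star_weight x y
                            + (x == theta C0)%:R * (y == theta C0)%:R) =
  \prod_v sole_order v *
  fdet (fun C C' => laplacian quotient_weight C C' + (C == C0)%:R * (C' == C0)%:R).
Proof.
pose A : {set vert G} := [set v | sole_class v != None].
pose P := {v in A}.
pose h (x : P + vert H) : vert K :=
  match x with inl p => inr (val p) | inr C => theta C end.
have bij_h : bijective h.
  apply: inj_card_bij.
    case=> [p|C] [p'|C'] //=.
    - by move=> [/val_inj->].
    - by move/esym/eqP; rewrite theta_pendant //; have := valP p; rewrite inE.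
    - by move/eqP; rewrite theta_pendant //; have := valP p'; rewrite inE.
    - by move/inj_theta->.
  have surj x : exists z, h z = x.
    case: x => [i|v]; first by exists (inr (v' i)); rewrite /= theta_class.
    have [hv|hv] := eqVneq (sole_class v) None; last first.
      have vA : v \in A by rewrite inE.
      by exists (inl (exist _ v vA)).
    by have [C CE] := (theta_centre v).1 hv; exists (inr C).
  have /fin_all_exists[g gE] := surj.
  by apply: (leq_card g) => x y xy; rewrite -(gE x) xy gE.
have hP (p : P) : exists2 j, sole_class (val p) = Some j &
    sole_order (val p) = class_order j.
  by have := valP p; rewrite inE /sole_order; case: (sole_class _) => // j _; exists j.
have pN (p : P) C : (inr (val p) == theta C) = false.
  by rewrite eq_sym theta_pendant //; have := valP p; rewrite inE.
rewrite (fdet_reindex _ bij_h).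
rewrite (@fdet_elim _ P (vert H) _ (fun p => sole_order (val p))).
- congr (_ * _).
    rewrite -(big_sub A sole_order) /= big_mkcond; apply: eq_bigr => v _.
    by rewrite inE /sole_order; case: (sole_class v).
  apply: eq_fdet => C C' /=; rewrite !(inj_eq inj_theta) star_laplacian_quotient.
  rewrite addrAC; congr (_ + _).
  rewrite -[RHS]addr0 -addrA; congr (_ + _); apply/eqP; rewrite subr_eq0; apply/eqP.
  rewrite [LHS](eq_bigl (mem A)) => [|v]; last by rewrite /= inE.
  rewrite big_sub; apply: eq_bigr => p _; have [j hj ->] := hP p.
  rewrite !pN mulr0 mul0r !addr0 (laplacian_sym _ (inr _ : vert K)).
  rewrite !(star_laplacian_pendant _ hj) hj mulrNN.
  have := class_order_neq0 class_nonempty j; move: (class_order j) => m m0.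
  by field.
- move=> p p' /=; rewrite !pN mul0r addr0 star_laplacian_rr (inj_eq val_inj).
  case: eqP => _; last by rewrite mul0r.
  have [j hj ->] := hP p; rewrite mul1r -[RHS]mulr1 -(sum_pendant (fun=> 1) hj).
  by apply: eq_bigr => i _; rewrite mulr1.
- by move=> p; have [j _ ->] := hP p; apply: class_order_neq0.
Qed.

End Pendants.

(** * The tree formula *)

Lemma spanning_trees_void (G : mgraph) :
  (vert G -> False) -> spanning_trees G = [set set0].
Proof.
move=> noV; apply/setP=> T; rewrite !inE.
have -> : T = set0 by apply/setP=> e; case: (noV (ends e).1).
rewrite eqxx; apply/andP; split; first by apply/forallP=> x; case: (noV x).
by apply/acyclicP=> e; case: (noV (ends e).1).
Qed.

Lemma tau_sum (R : nzRingType) (G : mgraph) :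
  (tau G)%:R = \sum_(T in spanning_trees G) \prod_(e in T) 1 :> R.
Proof. by under eq_bigr do rewrite big1_eq; rewrite sumr_const. Qed.

Lemma prod_sole_order (G : mgraph) (I : finType) (cl : edge G -> I) :
  \prod_v sole_order cl v =
  \prod_i class_order cl i ^+
    #|[set v in edge_verts (class_edges cl i) | edges_at v \subset class_edges cl i]|.
Proof.
transitivity (\prod_v \prod_(i | sole_class cl v == Some i) class_order cl i).
  apply: eq_bigr => v _; rewrite /sole_order; case: (sole_class cl v) => [i|].
    by rewrite (big_pred1 i) // => j; rewrite /= (inj_eq (@Some_inj _)) eq_sym.
  by rewrite big_pred0.
rewrite (exchange_big_dep predT) //=; apply: eq_bigr => i _.
rewrite prodr_const; congr (_ ^+ _); apply: eq_card => v; rewrite [RHS]inE.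
transitivity (sole_class cl v == Some i); first by [].
by apply/eqP/andP => [/sole_classP //|vi]; apply/sole_classP.
Qed.

(** The two evaluations of the tree sum of [K], for a partition given by the class
map [cl]. *)
Lemma tau_class_graph (G : mgraph) (I : finType) (cl : edge G -> I) :
    loopless G -> (forall i, exists e, cl e = i) ->
    (forall i, complete (edge_induced (class_edges cl i))) ->
  let V i := edge_verts (class_edges cl i) in
  let X := diamond [seq class_edges cl i | i <- enum I] in
  let EG := ext_edges X [set: edge G] in
  let H := contract EG in
  exists v' : I -> vert H,
    (forall i, edge_verts (ext_edges X (class_edges cl i)) =
               [set x | contract_proj EG x == v' i]) /\
    \prod_i #|V i|%:R ^+ 2 * (tau G)%:R =
      \prod_i #|V i|%:R ^+ #|[set v in V i | edges_at v \subset class_edges cl i]| *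
      \sum_(T in spanning_trees H)
        \prod_i #|V i|%:R ^+ #|T :&: edges_at (v' i)| :> rat.
Proof.
move=> loopG neI complI V X EG H.
have [pv [pe [modX peE]]] := split_model_diamond cl (enum_uniq I).
rewrite (_ : [set i in enum I] = setT) in modX; last first.
  by apply/setP=> i; rewrite !inE mem_enum.
have cliqueI i u v : u \in V i -> v \in V i -> u != v ->
    exists2 e, cl e = i & joins e u v.
  move=> ui vi uv; have /eqP/cards1P[e /setP/(_ e)] := complI i _ _ ui vi uv.
  by rewrite !inE eqxx => /andP[/eqP ei euv]; exists e.
have [theta [phi [v' [[[inj_theta inj_phi] theta_v' theta_c phi_D theta_ends] v'V]]]] :=
  contract_bipartite neI cliqueI modX peE.
exists v'; split=> //.
(* Without vertices there is no root, but then both tree counts are 1. *)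
case: (pickP (fun _ : vert G => true)) => [r _|noG]; last first.
  have noV (v : vert G) : False by have := noG v.
  have noI (i : I) : False by have [e _] := neI i; apply: noV (ends e).1.
  have noH (C : vert H) : False.
    have [x _] := contract_proj_surj C.
    by case: (pv x) => v _; apply: noV v.
  have prodI (g : I -> rat) : \prod_i g i = 1 by rewrite big1 // => i; case: (noI i).
  rewrite !prodI !mul1r /tau (spanning_trees_void noV).
  by rewrite (spanning_trees_void noH) cards1 big_set1 prodI.
have [y _] := model_centre modX r; pose C0 : vert H := contract_proj EG y.
have sumT (T : {set edge H}) :
    \prod_i #|V i|%:R ^+ #|T :&: edges_at (v' i)| =
    \prod_(f in T) quotient_weight cl phi f.
  rewrite [RHS](partition_big (fun f => (phi f).2) predT) //=.
  apply: eq_bigr => i _.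
  rewrite (eq_bigr (fun=> class_order cl i)) => [|f /andP[_ /eqP<-]] //.
  rewrite prodr_const; congr (_ ^+ _); apply: eq_card => f.
  rewrite !inE /incident; congr andb.
  have [e1 e2] := theta_ends f.
  by rewrite -!(inj_eq inj_theta) theta_v' e1 e2 orbF eq_sym.
rewrite [X in _ = _ * X](eq_bigr _ (fun T _ => sumT T)).
rewrite (matrix_tree C0) -(prod_sole_order cl).
rewrite -(pendant_fdet neI inj_theta inj_phi theta_v' theta_c phi_D theta_ends).
rewrite -matrix_tree (matrix_tree (inr r : vert (incidence_graph G I))).
by rewrite star_clique_fdet // -matrix_tree -tau_sum.
Qed.

Theorem theorem5p1 (G : mgraph) (k : nat) (S : 'I_k -> {set edge G})
    (hG : loopless G)
    (hinj : injective S)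
    (hpart : partition [set S i | i : 'I_k] [set: edge G])
    (hcompl : forall i : 'I_k, complete (edge_induced (S i))) :
  let n (i : 'I_k) : nat := #|edge_verts (S i)| in
  let n' (i : 'I_k) : nat :=
    #|[set v in edge_verts (S i) | ~~ (edges_at v \subset S i)]| in
  let X := diamond [seq S i | i <- enum 'I_k] in
  let EG := ext_edges X [set: edge G] in
  let H := contract EG in
  exists v' : 'I_k -> vert H,
    (forall i : 'I_k,
       edge_verts (ext_edges X (S i)) = [set x | contract_proj EG x == v' i]) /\
    (tau G)%:R =
      \prod_(i < k) (n i)%:R ^ ((n i)%:Z - 2 - (n' i)%:Z) *
      \sum_(T in spanning_trees H)
        \prod_(i < k) (n i)%:R ^+ #|T :&: edges_at (v' i)| :> rat.
Proof.
case/and3P: hpart => /eqP coverS /trivIsetP disjS S0.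
have /fin_all_exists[cl clE] e : exists i, e \in S i.
  have : e \in cover [set S i | i : 'I_k] by rewrite coverS inE.
  by case/bigcupP=> _ /imsetP[i _ ->]; exists i.
have SE i : S i = class_edges cl i.
  apply/setP=> e; rewrite inE; apply/idP/eqP => [ei|<-]; last exact: clE.
  apply/eqP; apply: contraT => ne; have := disjS (S (cl e)) (S i).
  rewrite !imset_f // (inj_eq hinj) => /(_ isT isT ne) /pred0P/(_ e) /=.
  by rewrite clE ei.
have neI i : exists e, cl e = i.
  have /set0Pn[e] : S i != set0 by apply: contraNneq S0 => <-; apply: imset_f.
  by rewrite SE inE => /eqP; exists e.
have complI i : complete (edge_induced (class_edges cl i)) by rewrite -SE.
have := tau_class_graph hG neI complI.
rewrite -(eq_map SE) => -[v' [v'V tauE]].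
exists v'; split=> [i|]; first by rewrite SE.
have n0 i : #|edge_verts (S i)|%:R != 0 :> rat.
  by rewrite SE; apply: class_order_neq0.
have n2 : \prod_i #|edge_verts (S i)|%:R ^+ 2 != 0 :> rat.
  by apply/prodf_neq0 => i _; rewrite expf_neq0.
apply: (mulfI n2); rewrite mulrA -big_split /=.
under [X in X * _ = _]eq_bigr do rewrite SE.
rewrite {}tauE; congr (_ * _); last first.
  by apply: eq_bigr => T _; apply: eq_bigr => i _; rewrite SE.
apply: eq_bigr => i _; rewrite -SE !exprnP -expfzDr //; congr (_ ^ _).
rewrite -(cardsID [set v | edges_at v \subset S i] (edge_verts (S i))) PoszD.
rewrite (_ : _ :&: _ = [set v in edge_verts (S i) | edges_at v \subset S i]);
  last first.
  by apply/setP=> v; rewrite !inE.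
rewrite (_ : _ :\: _ = [set v in edge_verts (S i) | ~~ (edges_at v \subset S i)]);
  last first.
  by apply/setP=> v; rewrite !inE andbC.
have arith (a b : int) : 2 + (a + b - 2 - b) = a by ring.
exact: esym (arith _ _).
Qed.
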